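(* Let $\mathcal{H}=(V,E)$ be a hypergraph with rank $r$ and co-rank $s$. If $\rho(\mathbf{Q})$ denotes the spectral radius of its signless Laplacian matrix $\mathbf{Q}$, then $$\min_{e\in E}\left\{\sum_{v\in e}d(v)\right\}-(r-s)\leq\rho(\mathbf{Q})\leq\max_{e\in E}\left\{\sum_{v\in e}d(v)\right\}+(r-s).$$ Either equality holds if and only if $\mathcal{H}$ is both uniform and edge-regular (that is, each of the two equalities, separately, is equivalent to $\mathcal{H}$ being both uniform and edge-regular).
   Context: A hypergraph $\mathcal{H}=(V,E)$ consists of a finite set $V$ of vertices and a set $E$ of non-empty subsets of $V$, called hyperedges. All hypergraphs are assumed simple (no hyperedge has cardinality one and no hyperedge is contained in another) and connected (any two vertices are joined by a path, i.e. an alternating sequence of distinct vertices and hyperedges in which each hyperedge contains the vertices immediately before and after it). The rank and co-rank of $\mathcal{H}$ are the largest and smallest cardinality of its hyperedges, respectively (so $E\neq\emptyset$ when they are mentioned). $\mathcal{H}$ is uniform if all its hyperedges have the same cardinality. The degree $d(v)$ of a vertex $v$ is the number of hyperedges containing $v$. $\mathcal{H}$ is edge-regular if the sum $\sum_{v\in e}d(v)$ takes the same value for every hyperedge $e\in E$. The incidence matrix $\mathbf{B}$ is the $|V|\times|E|$ matrix with $(v,e)$ entry $1$ if $v\in e$ and $0$ otherwise. The signless Laplacian matrix of $\mathcal{H}$ is the $|V|\times|V|$ matrix $\mathbf{Q}=\mathbf{B}\mathbf{B}^{\mathrm{T}}$, and $\rho(\mathbf{Q})$ is its largest eigenvalue.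 *)

(* Defs.v *)
From HB Require Import structures.
From mathcomp Require Import all_boot all_order all_algebra.
From mathcomp Require Import polyrcf.

Set Implicit Arguments.
Unset Strict Implicit.
Unset Printing Implicit Defensive.

Import Order.TTheory GRing.Theory Num.Theory.
Local Open Scope nat_scope.

Record hypergraph (V : finType) := Hypergraph {
  edges : {set {set V}};
  edges_neq0 : set0 \notin edges
}.

Definition simple_hypergraph (V : finType) (H : hypergraph V) : Prop :=
  (forall e, e \in edges H -> #|e| <> 1) /\
  (forall e f, e \in edges H -> f \in edges H -> e \subset f -> e = f).

(* The walk x, e_1, v_1, ..., e_k, v_k is encoded by its start x and the list
   [:: (e_1, v_1); ...; (e_k, v_k)]. *)
Fixpoint hwalk (V : finType) (H : hypergraph V) (x : V)
    (p : seq ({set V} * V)) : bool :=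
  if p is (e, y) :: p' then
    [&& e \in edges H, x \in e, y \in e & hwalk H y p']
  else true.

Definition hpath (V : finType) (H : hypergraph V) (x : V)
    (p : seq ({set V} * V)) : bool :=
  [&& hwalk H x p, uniq (x :: unzip2 p) & uniq (unzip1 p)].

Definition connected_hypergraph (V : finType) (H : hypergraph V) : Prop :=
  forall x y : V, exists2 p, hpath H x p & last x (unzip2 p) = y.

Definition max_edge (V : finType) (H : hypergraph V) (f : {set V} -> nat) : nat :=
  \max_(e in edges H) f e.

(* Seeding with the maximum makes this the true minimum as soon as there is a
   hyperedge; see [min_edge_spec]. *)
Definition min_edge (V : finType) (H : hypergraph V) (f : {set V} -> nat) : nat :=
  \big[minn/max_edge H f]_(e in edges H) f e.

Definition rank (V : finType) (H : hypergraph V) : nat :=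
  max_edge H (fun e => #|e|).

Definition corank (V : finType) (H : hypergraph V) : nat :=
  min_edge H (fun e => #|e|).

Definition uniform (V : finType) (H : hypergraph V) : Prop :=
  forall e f, e \in edges H -> f \in edges H -> #|e| = #|f|.

Definition degree (V : finType) (H : hypergraph V) (v : V) : nat :=
  #|[set e in edges H | v \in e]|.

Definition edge_degree_sum (V : finType) (H : hypergraph V) (e : {set V}) : nat :=
  \sum_(v in e) degree H v.

Definition edge_regular (V : finType) (H : hypergraph V) : Prop :=
  forall e f, e \in edges H -> f \in edges H ->
    edge_degree_sum H e = edge_degree_sum H f.

Local Open Scope ring_scope.

Definition incidence_mx (R : rcfType) (V : finType) (H : hypergraph V) :
    'M[R]_(#|V|, #|edges H|) :=
  \matrix_(i, j) ((enum_val i : V) \in (enum_val j : {set V}))%:R.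

Definition signless_laplacian (R : rcfType) (V : finType) (H : hypergraph V) :
    'M[R]_#|V| :=
  incidence_mx R H *m (incidence_mx R H)^T.

(* [rootsR p] lists the roots of [p] in increasing order; the default 0 is only
   used for a matrix without eigenvalues in [R]. *)
Definition largest_eigenvalue (R : rcfType) (n : nat) (A : 'M[R]_n) : R :=
  last 0 (rootsR (char_poly A)).

Lemma largest_eigenvalueP (R : rcfType) (n : nat) (A : 'M[R]_n) (a : R) :
  eigenvalue A a ->
  eigenvalue A (largest_eigenvalue A) /\ a <= largest_eigenvalue A.
Proof.
have p0 : char_poly A != 0 by rewrite monic_neq0 ?char_poly_monic.
have mem x : (x \in rootsR (char_poly A)) = eigenvalue A x.
  by rewrite eigenvalue_root_char -(roots_on_rootsR p0) in_itv.
rewrite -!mem /largest_eigenvalue.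
have: sorted <%R (rootsR (char_poly A)) by apply: sorted_roots.
case/lastP: (rootsR _) => // s x srt ain; rewrite last_rcons.
split; first by rewrite mem_rcons mem_head.
move: srt ain; rewrite (sorted_pairwise lt_trans) pairwise_rcons.
by case/andP=> /allP lt_x _; rewrite mem_rcons inE => /predU1P[->|/lt_x/ltW].
Qed.

Lemma max_edge_spec (V : finType) (H : hypergraph V) (f : {set V} -> nat) :
  edges H != set0 ->
  (exists2 e, e \in edges H & max_edge H f = f e) /\
  (forall e, e \in edges H -> (f e <= max_edge H f)%N).
Proof.
move=> /set0Pn[e0 e0H]; split; last by move=> e; apply: leq_bigmax_cond.
have E_gt0 : (0 < #|edges H|)%N by apply/card_gt0P; exists e0.
by have [e eH maxE] := eq_bigmax_cond f E_gt0; exists e.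
Qed.

Lemma min_edge_spec (V : finType) (H : hypergraph V) (f : {set V} -> nat) :
  edges H != set0 ->
  (exists2 e, e \in edges H & min_edge H f = f e) /\
  (forall e, e \in edges H -> (min_edge H f <= f e)%N).
Proof.
move=> /(max_edge_spec f)[[e0 e0H maxE] _]; split.
  rewrite /min_edge; elim/big_ind: _ => [|x y [e eH ->] [e' e'H ->]|e eH].
  - by exists e0.
  - by case: leqP => _; [exists e | exists e'].
  - by exists e.
move=> e eH; rewrite /min_edge.
have : e \in index_enum {set V} by rewrite mem_index_enum.
elim: (index_enum _) => // e1 s IHs; rewrite inE big_cons.
case/predU1P=> [<-|/IHs le_s]; first by rewrite eH geq_minl.
by case: ifP => // _; apply: leq_trans (geq_minr _ _) le_s.
Qed.

(* Main.v *)
(* The Gram matrix K = B^T B has entries |e :&: f|, so its column sums are the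
   degree sums D(e) = \sum_(v in e) d(v), and it has the same nonzero
   eigenvalues as Q = B B^T.

   Upper bound: an eigenvector of K at a coordinate of maximal absolute value
   gives rho <= max D; if equality holds, maximality and D(e) = max D propagate
   from a hyperedge to every hyperedge meeting it, hence everywhere by
   connectedness.

   Lower bound: the Rayleigh quotient of Q at the vector B 1 is
   (\sum_e D(e)^2) / (\sum_e D(e)), which is at least min D, with equality only
   if D is constant.

   So min D <= rho <= max D already holds, and the nonnegative term r - s must
   vanish in case of equality. *)
Require Import Defs.
From mathcomp Require Import all_boot all_order all_algebra.
From mathcomp Require Import polyrcf complex.

Import Order.TTheory GRing.Theory Num.Theory.
Local Open Scope ring_scope.

(** * Rayleigh quotients, and the spectra of the products MN and NM *)

Lemma rayleigh_le_largest_eigenvalue (R : rcfType) (n : nat) (A : 'M[R]_n)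
    (x : 'rV[R]_n) :
  A^T = A ->
  (x *m A *m x^T) 0 0 <= largest_eigenvalue A * (x *m x^T) 0 0.
Proof.
(* Over [R[i]] the symmetric matrix becomes Hermitian, so the spectral theorem diagonalises it by a
   unitary [P]. *)
move=> symA; set f := real_complex R; set rho := largest_eigenvalue A.
set Ac := map_mx f A; set P := spectralmx Ac; set d := spectral_diag Ac.
have realE (k : R) : (f k)^* = f k by apply/conj_Creal/complex_realP; exists k.
have Aherm : Ac \is hermsymmx.
  apply/is_hermitianmxP; rewrite expr0 scale1r /Ac map_trmx symA.
  by apply/matrixP => i j; rewrite !mxE realE.
have AE : Ac = invmx P *m diag_mx d *m P.
  by apply/orthomx_spectralP/hermitian_normalmx.
have Punit : P \in unitmx by apply: spectral_unit.
have Pinv : invmx P = map_mx Num.conj P^T.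
  by rewrite invmx_unitary ?spectral_unitarymx.
(* Row [i] of [P] is an eigenvector for [d 0 i], which is real; its preimage under [f] is a root of
   the characteristic polynomial of [A] itself. *)
have d_le i : d 0 i <= f rho.
  have /complex_realP[k dk] : d 0 i \is Num.real.
    by have /mxOverP := hermitian_spectral_diag_real Aherm; apply.
  rewrite dk lecR; apply: (proj2 (largest_eigenvalueP _)).
  rewrite eigenvalue_root_char -(fmorph_root f) map_char_poly -/Ac.
  rewrite -eigenvalue_root_char; apply/eigenvalueP.
  exists (delta_mx 0 i *m P).
    rewrite {1}AE !mulmxA mulmxK // -(rowE i (diag_mx d)) row_diag_mx dk.
    by rewrite -scalemxAl.
  apply/eqP => /(congr1 (mulmx^~ (invmx P))); rewrite mulmxK // mul0mx.
  by move=> /matrixP /(_ 0 i); rewrite !mxE !eqxx => /eqP; rewrite oner_eq0.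
(* Coordinates of [x] in the eigenbasis: the two quadratic forms become the sums of d_i |y_i|^2 and
   of |y_i|^2. *)
set y := map_mx f x *m invmx P.
have yE : map_mx Num.conj y^T = P *m map_mx f x^T.
  rewrite /y Pinv trmx_mul map_mxM map_trmx trmxK -map_mx_comp.
  rewrite (map_mx_id (@conjCK _)); congr (_ *m _); rewrite map_trmx.
  by apply/matrixP => i j; rewrite !mxE; apply: realE.
have fE (M : 'M_1) : f (M 0 0) = map_mx f M 0 0 by rewrite [RHS]mxE.
have fM : {morph f : a b / a * b} by apply: rmorphM.
rewrite -lecR -/f fM !fE.
have -> : map_mx f (x *m A *m x^T) = y *m diag_mx d *m map_mx Num.conj y^T.
  by rewrite yE !map_mxM -/Ac AE /y !mulmxA.
have -> : map_mx f (x *m x^T) = y *m map_mx Num.conj y^T.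
  by rewrite yE map_mxM /y !mulmxA mulmxKV.
rewrite mul_mx_diag !mxE mulr_sumr ler_sum // => i _.
rewrite !mxE [_ * d 0 i]mulrC -mulrA ler_wpM2r //; exact: mul_conjC_ge0.
Qed.

(** An eigenvector [v] of MN yields [v *m M] for NM; were it zero, a v = v M N would vanish too. *)
Lemma eigenvalue_mulmxC (F : fieldType) (m n : nat) (M : 'M[F]_(m, n))
    (N : 'M[F]_(n, m)) (a : F) :
  a != 0 -> eigenvalue (M *m N) a -> eigenvalue (N *m M) a.
Proof.
move=> a0 /eigenvalueP[v vM v0]; apply/eigenvalueP; exists (v *m M).
  by rewrite mulmxA -(mulmxA v) vM scalemxAl.
apply: contra_neq v0 => vM0; apply/eqP.
by move: vM => /esym/eqP; rewrite mulmxA vM0 mul0mx scalemx_eq0 (negPf a0).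
Qed.

(** * Column-sum bound for eigenvalues of nonnegative matrices *)

Section NonnegativeMatrix.
Variables (R : realFieldType) (n : nat) (A : 'M[R]_n) (a c : R).
Hypotheses (A_ge0 : forall i j, 0 <= A i j)
  (colA : forall j, \sum_i A i j <= c) (eigA : eigenvalue A a).

Lemma max_coord_eigenvector :
  exists (v : 'rV[R]_n) (M : R), [/\ 0 < M, forall i, `|v 0 i| <= M,
    exists i, `|v 0 i| = M &
    forall j, `|v 0 j| = M ->
      `|a| * M <= \sum_i `|v 0 i| * A i j <= (\sum_i A i j) * M].
Proof.
have [v vA v0] := eigenvalueP eigA.
have [i0 vi0] : exists i, v 0 i != 0 by apply/rV0Pn.
have [i1 _ maxi1] := Order.TotalTheory.arg_maxP (fun i => `|v 0 i|) (erefl : xpredT i0).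
exists v, `|v 0 i1|; split.
- by apply: lt_le_trans (maxi1 i0 isT); rewrite normr_gt0.
- by move=> i; apply: maxi1.
- by exists i1.
move=> j jM; apply/andP; split.
  have /matrixP/(_ 0 j) := vA; rewrite !mxE -jM -normrM => <-.
  apply: le_trans (ler_norm_sum _ _ _) _; apply: ler_sum => i _.
  by rewrite normrM (ger0_norm (A_ge0 _ _)).
rewrite mulr_suml; apply: ler_sum => i _.
by rewrite mulrC ler_wpM2l //; apply: maxi1.
Qed.

Lemma nonneg_eigenvalue_le : a <= c.
Proof.
have [v [M [M0 _ [j jM] /(_ j jM) /andP[le1 le2]]]] := max_coord_eigenvector.
apply: le_trans (ler_norm a) _; rewrite -(ler_pM2r M0).
by apply: le_trans le1 (le_trans le2 _); rewrite ler_pM2r.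
Qed.

(** The first hypothesis is irreducibility. When a = c, both bounds are tight at each coordinate of
    maximal absolute value, so maximality spreads along the nonzero entries of [A] to all
    coordinates. *)
Lemma nonneg_eigenvalue_eq :
    (forall S : {set 'I_n}, S != set0 ->
       (forall i j, j \in S -> A i j != 0 -> i \in S) -> S = setT) ->
  a = c -> forall j, \sum_i A i j = c.
Proof.
move=> irrA aE; have [v [M [M0 leM [j jM] maxv]]] := max_coord_eigenvector.
have tight k : `|v 0 k| = M ->
    \sum_i `|v 0 i| * A i k = (\sum_i A i k) * M /\ \sum_i A i k = c.
  move=> kM; have /andP[le1 le2] := maxv k kM.
  have le0 : c * M <= `|a| * M by rewrite ler_pM2r // -aE ler_norm.
  have le3 : (\sum_i A i k) * M <= c * M by rewrite ler_pM2r.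
  split; apply/eqP; first by rewrite eq_le le2 (le_trans le3 (le_trans le0 le1)).
  rewrite eq_le colA -(ler_pM2r M0).
  by rewrite (le_trans le0 (le_trans le1 le2)).
have ST : [set k | `|v 0 k| == M] = setT.
  apply: irrA => [|i k]; first by apply/set0Pn; exists j; rewrite inE jM.
  (* Tightness says that the nonnegative terms (M - |v_l|) A l k sum to 0, so each one vanishes. *)
  rewrite !inE => /eqP /tight[+ _] Aik; rewrite mulr_suml => /esym/eqP.
  rewrite -subr_eq0 -sumrB psumr_eq0 => [/allP/(_ i (mem_index_enum _))|l _].
    rewrite /= mulrC -mulrBl mulf_eq0 (negPf Aik) orbF subr_eq0.
    by rewrite eq_sym.
  by rewrite mulrC -mulrBl mulr_ge0 // subr_ge0.
move=> k; have : k \in [set k | `|v 0 k| == M] by rewrite ST inE.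
by rewrite inE => /eqP /tight[].
Qed.

End NonnegativeMatrix.

(** * Propagation along hyperedges, and extrema over them *)

Section Hypergraph.
Variables (V : finType) (H : hypergraph V).

(** Join a vertex of [e] to a vertex of [f]: along the path, consecutive hyperedges share a vertex,
    so [P] is handed on from [e] to [f]. *)
Lemma connected_edges_ind (P : pred {set V}) :
    connected_hypergraph H ->
    (forall e f x, e \in edges H -> f \in edges H -> x \in e -> x \in f ->
       P e -> P f) ->
  forall e f, e \in edges H -> f \in edges H -> P e -> P f.
Proof.
move=> connH stepP e f eH fH.
have inh g : g \in edges H -> exists x, x \in g.
  by move=> gH; apply/set0Pn; apply: contraNneq (edges_neq0 H) => <-.
have [[x xe] [y yf]] := (inh e eH, inh f fH).
have [p /and3P[walkp _ _] lastp] := connH x y.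
elim: p x e eH xe walkp lastp => [|[g z] p IHp] x e eH xe /=.
  by move=> _ xy; apply: (stepP _ _ x) => //; rewrite xy.
case/and4P=> gH xg zg walkp lastp Pe.
exact: (IHp z g gH zg walkp lastp (stepP _ _ x eH gH xe xg Pe)).
Qed.

Lemma edge_degree_sum_gt0 e : e \in edges H -> (0 < edge_degree_sum H e)%N.
Proof.
move=> eH; have /set0Pn[x xe] : e != set0.
  by apply: contraNneq (edges_neq0 H) => <-.
rewrite /edge_degree_sum (bigD1 x) //= ltn_addr // /degree.
by apply/card_gt0P; exists e; rewrite inE eH.
Qed.

Hypothesis edgesH : edges H != set0.

Lemma min_edge_le_max f : (min_edge H f <= max_edge H f)%N.
Proof.
have [[e eH ->] _] := min_edge_spec f edgesH.
by have [_ ->] := max_edge_spec f edgesH.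
Qed.

Lemma min_edge_eq_max f :
  min_edge H f = max_edge H f <->
  (forall e e', e \in edges H -> e' \in edges H -> f e = f e').
Proof.
have [[e eH minE] le_min] := min_edge_spec f edgesH.
have [[e' e'H maxE] le_max] := max_edge_spec f edgesH.
split=> [min_max|const_f]; last by rewrite minE maxE; apply: const_f.
have constE g : g \in edges H -> f g = min_edge H f.
  by move=> gH; apply/eqP; rewrite eqn_leq le_min // andbT min_max le_max.
by move=> g g' gH g'H; rewrite !constE.
Qed.

(** * The incidence matrix, its Gram matrix and the two bounds *)

Variable R : rcfType.
Local Notation B := (incidence_mx R H).
Local Notation D j := (edge_degree_sum H (enum_val (j : 'I_#|edges H|))).

(** Double counting: each vertex of hyperedge [j] is counted once for every hyperedge containing
    it. *)
Lemma incidence_gram_col_sum j : \sum_i (B^T *m B) i j = (D j)%:R :> R.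
Proof.
rewrite /edge_degree_sum natr_sum.
under [LHS]eq_bigr do rewrite mxE.
rewrite exchange_big /= [RHS]big_mkcond /=.
rewrite [RHS](reindex _ (onW_bij _ (@enum_val_bij V))) /=.
apply: eq_bigr => k _; under eq_bigr do rewrite !mxE.
rewrite -mulr_suml; case: (enum_val k \in _); last by rewrite mulr0.
rewrite mulr1 -natr_sum; congr _%:R.
rewrite /degree -sum1_card -(big_enum_val (fun e : {set V} => (enum_val k \in e) : nat)).
by rewrite big_mkcond /= [RHS]big_mkcond; apply: eq_bigr => e _; rewrite inE; do 2!case: (_ \in _).
Qed.

Local Notation rho := (largest_eigenvalue (signless_laplacian R H)).
Local Notation dmin := (min_edge H (edge_degree_sum H)).
Local Notation dmax := (max_edge H (edge_degree_sum H)).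

(** The test vector [u *m B^T] is the vector of degrees. Since [w] lists the sums [D j], the two
    quadratic forms are w w^T and w u^T. *)
Lemma sum_sqr_edge_degree_sum_le :
  \sum_j (D j)%:R ^+ 2 <= rho * \sum_j (D j)%:R.
Proof.
set u : 'rV[R]_#|edges H| := const_mx 1.
have uK j : (u *m B^T *m B) 0 j = (D j)%:R.
  rewrite -incidence_gram_col_sum -mulmxA mxE.
  by apply: eq_bigr => i _; rewrite mxE mul1r.
have := @rayleigh_le_largest_eigenvalue _ _ (signless_laplacian R H) (u *m B^T).
rewrite /signless_laplacian trmx_mul trmxK => /(_ erefl).
set w := u *m B^T *m B in uK *.
have -> : u *m B^T *m (B *m B^T) *m (u *m B^T)^T = w *m w^T.
  by rewrite /w [in RHS]trmx_mul !mulmxA.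
have -> : u *m B^T *m (u *m B^T)^T = w *m u^T.
  by rewrite trmx_mul trmxK !mulmxA.
have -> : (w *m w^T) 0 0 = \sum_j (D j)%:R ^+ 2.
  by rewrite mxE; apply: eq_bigr => j _; rewrite [_^T _ _]mxE uK.
have -> // : (w *m u^T) 0 0 = \sum_j (D j)%:R.
by rewrite mxE; apply: eq_bigr => j _; rewrite [_^T _ _]mxE [u _ _]mxE mulr1 uK.
Qed.

(** Sum the inequalities D_j (D_j - dmin) >= 0 and divide by the positive sum of the D_j. In case of
    equality every term is 0, and D_j > 0 leaves D_j = dmin. *)
Lemma min_edge_le_largest_eigenvalue :
  dmin%:R <= rho /\ (dmin%:R = rho -> edge_regular H).
Proof.
have [_ le_min] := min_edge_spec (edge_degree_sum H) edgesH.
have D_ge j : dmin%:R <= (D j)%:R :> R by rewrite ler_nat le_min ?enum_valP.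
have D_gt0 j : 0 < (D j)%:R :> R.
  by rewrite ltr0n edge_degree_sum_gt0 ?enum_valP.
have S_gt0 : 0 < \sum_j (D j)%:R :> R.
  have [e eH] := set0Pn _ edgesH.
  by rewrite (bigD1 (enum_rank_in eH e)) //= ltr_wpDr ?sumr_ge0.
have term_ge0 j : 0 <= (D j)%:R ^+ 2 - dmin%:R * (D j)%:R :> R.
  by rewrite expr2 -mulrBl mulr_ge0 ?subr_ge0 // ltW.
have sumE : \sum_j ((D j)%:R ^+ 2 - dmin%:R * (D j)%:R) =
    \sum_j (D j)%:R ^+ 2 - dmin%:R * \sum_j (D j)%:R :> R.
  by rewrite sumrB -mulr_sumr.
have le_rho := sum_sqr_edge_degree_sum_le; split=> [|rhoE].
  rewrite -(ler_pM2r S_gt0); apply: le_trans le_rho.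
  by rewrite -subr_ge0 -sumE sumr_ge0.
have : \sum_j ((D j)%:R ^+ 2 - dmin%:R * (D j)%:R) == 0 :> R.
  by rewrite eq_le sumr_ge0 // andbT sumE subr_le0 rhoE.
rewrite psumr_eq0 // => /allP D_eq.
have constD e : e \in edges H -> edge_degree_sum H e = dmin.
  move=> eH; have := D_eq (enum_rank_in eH e) (mem_index_enum _).
  rewrite /= expr2 -mulrBl mulf_eq0 (gt_eqF (D_gt0 _)) orbF subr_eq0 eqr_nat.
  by rewrite enum_rankK_in // => /eqP.
by move=> e f eH fH; rewrite !constD.
Qed.

Lemma largest_eigenvalue_gt0 : 0 < rho.
Proof.
have [[e eH minE] _] := min_edge_spec (edge_degree_sum H) edgesH.
apply: lt_le_trans min_edge_le_largest_eigenvalue.1.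
by rewrite ltr0n minE edge_degree_sum_gt0.
Qed.

Lemma gram_eigenvalue : eigenvalue (B^T *m B) rho.
Proof.
have rho0 := largest_eigenvalue_gt0; apply: eigenvalue_mulmxC.
  by rewrite gt_eqF.
(* [rho] lies in the root list with 0 prepended; being positive, it is not the default 0 but a true
   root. *)
have := mem_last 0 (rootsR (char_poly (signless_laplacian R H))).
rewrite inE gt_eqF //= -roots_on_rootsR ?monic_neq0 ?char_poly_monic //.
by rewrite in_itv /= eigenvalue_root_char.
Qed.

(** Entries of the Gram matrix are nonzero for hyperedges that meet, so a closed set of indices
    absorbs neighbours and connectedness fills it up. *)
Lemma incidence_gram_irreducible (S : {set 'I_#|edges H|}) :
    connected_hypergraph H -> S != set0 ->
  (forall i j, j \in S -> (B^T *m B) i j != 0 -> i \in S) -> S = setT.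
Proof.
move=> connH /set0Pn[i iS] closedS; apply/setP => j; rewrite [RHS]inE.
have : enum_val j \in [set enum_val k | k in S].
  apply: (connected_edges_ind (fun e => e \in [set enum_val k | k in S]) connH
            _ _ _ (enum_valP i)) (enum_valP j) (imset_f _ iS).
  move=> e f x eH fH xe xf /imsetP[k kS eE].
  rewrite -(enum_rankK_in fH fH) imset_f //; apply: closedS kS _.
  rewrite mxE psumr_neq0 => [|l _]; last by rewrite !mxE mulr_ge0.
  (* The common vertex [x] contributes a term 1 to the entry. *)
  apply/hasP; exists (enum_rank x); first exact: mem_index_enum.
  by rewrite !mxE enum_rankK enum_rankK_in // -eE xe xf mulr1 ltr01.
by case/imsetP=> k kS /enum_val_inj ->.
Qed.

Lemma largest_eigenvalue_le_max_edge : connected_hypergraph H ->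
  rho <= dmax%:R /\ (rho = dmax%:R -> edge_regular H).
Proof.
move=> connH; have [_ le_max] := max_edge_spec (edge_degree_sum H) edgesH.
have gram_ge0 i j : 0 <= (B^T *m B) i j.
  by rewrite mxE sumr_ge0 // => k _; rewrite !mxE mulr_ge0.
have col_le j : \sum_i (B^T *m B) i j <= dmax%:R.
  by rewrite incidence_gram_col_sum ler_nat le_max ?enum_valP.
split=> [|rhoE]; first exact: nonneg_eigenvalue_le gram_ge0 col_le gram_eigenvalue.
have colE := nonneg_eigenvalue_eq _ _ _ _ _ gram_ge0 col_le gram_eigenvalue
  (fun S => incidence_gram_irreducible S connH) rhoE.
have constD e : e \in edges H -> edge_degree_sum H e = dmax.
  move=> eH; have /eqP := colE (enum_rank_in eH e).
  by rewrite incidence_gram_col_sum eqr_nat enum_rankK_in // => /eqP.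
by move=> e f eH fH; rewrite !constD.
Qed.

End Hypergraph.

Theorem theorem5p4 (R : rcfType) (V : finType) (H : hypergraph V)
    (simpleH : simple_hypergraph H) (connectedH : connected_hypergraph H)
    (edgesH : edges H != set0) :
  let r : R := (rank H)%:R in
  let s : R := (corank H)%:R in
  let rho : R := largest_eigenvalue (signless_laplacian R H) in
  let lower : R := (min_edge H (edge_degree_sum H))%:R - (r - s) in
  let upper : R := (max_edge H (edge_degree_sum H))%:R + (r - s) in
  [/\ lower <= rho <= upper,
      lower = rho <-> uniform H /\ edge_regular H
    & rho = upper <-> uniform H /\ edge_regular H].
Proof.
move=> r s rho lower upper.
have [min_le min_eq] := min_edge_le_largest_eigenvalue _ _ edgesH R.
have [max_ge max_eq] := largest_eigenvalue_le_max_edge _ _ edgesH R connectedH.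
have rs : 0 <= r - s by rewrite subr_ge0 ler_nat min_edge_le_max.
have unifP : r - s = 0 -> uniform H.
  move/eqP; rewrite subr_eq0 eqr_nat eq_sym => /eqP.
  by move/(min_edge_eq_max _ _ edgesH).
(* Here r = s and the minimum and maximum degree sums agree, so [rho] is squeezed between equal
   bounds. *)
have eq_all : uniform H /\ edge_regular H -> lower = rho /\ rho = upper.
  move=> [/(min_edge_eq_max _ _ edgesH) unifH /(min_edge_eq_max _ _ edgesH) regH].
  have rs0 : r - s = 0 by rewrite /r /s /rank /corank unifH subrr.
  rewrite /lower /upper rs0 subr0 addr0 -regH; split; apply/le_anti.
    by rewrite min_le regH max_ge.
  by rewrite min_le regH max_ge.
split.
- apply/andP; split.
    by apply: le_trans min_le; rewrite lerBlDr lerDl.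
  by apply: le_trans max_ge _; rewrite lerDl.
- split=> [lowE|/eq_all[]//].
  have rs0 : r - s = 0.
    (* lower + (r - s) is the minimum degree sum, which is at most rho = lower; hence r - s <= 0. *)
    apply/le_anti; rewrite rs andbT -(lerD2l lower) addr0.
    by rewrite {1}/lower subrK lowE.
  by split; [apply: unifP | apply: min_eq; rewrite -/rho -lowE /lower rs0 subr0].
split=> [upE|/eq_all[]//].
have rs0 : r - s = 0.
  apply/le_anti; rewrite rs andbT -(lerD2l (max_edge H (edge_degree_sum H))%:R) addr0.
  by rewrite -/upper -upE.
by split; [apply: unifP | apply: max_eq; rewrite -/rho upE /upper rs0 addr0].
Qed.
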